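(* Let $\{X_n\}$ and $\{Y_n\}$ be two sequences of random elements, where for each $n$ both $X_n$ and $Y_n$ take values in a complete separable normed space $(S_n,\|\cdot\|_n)$. For $r\ge1$ let $\mathsf{PL}_n(r)$ be the class of functions $f\colon S_n\to\mathbb{R}$ with $|f(x)-f(y)|\le\|x-y\|_n(1+\|x\|_n^{r-1}+\|y\|_n^{r-1})$ for all $x,y\in S_n$. Consider the statements: (i) there exists a sequence of couplings of $(X_n,Y_n)$ such that $\|X_n-Y_n\|_n\xrightarrow[n\to\infty]{\mathrm{p}}0$; (ii) $\lim_{t\to\infty}\limsup_{n\to\infty}\Pr(\|X_n\|_n\ge t)=0$ (or the same with $Y_n$ in place of $X_n$); (iii) there exists a sequence of couplings of $(X_n,Y_n)$ such that for every $r\ge1$ and every sequence of functions $f_n\in\mathsf{PL}_n(r)$, $|f_n(X_n)-f_n(Y_n)|\xrightarrow[n\to\infty]{\mathrm{p}}0$. Then (i) and (ii) together imply (iii), and (iii) implies (i).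
   Context: A coupling of $(X_n,Y_n)$ is a joint distribution on a common probability space with the given marginal laws of $X_n$ and $Y_n$. *)

(* Defs.v *)
From HB Require Import structures.
From mathcomp Require Import all_boot all_order all_algebra.
From mathcomp Require Import all_classical all_reals all_analysis.
Set Implicit Arguments. Unset Strict Implicit. Unset Printing Implicit Defensive.
Import Order.TTheory GRing.Theory Num.Theory.
Import numFieldNormedType.Exports.
Local Open Scope classical_set_scope.
Local Open Scope ring_scope.

Definition borel (T : topologicalType) : set (set T) := <<s open >>.

Definition separable_space (T : topologicalType) : Prop :=
  exists D : set T, countable D /\ closure D = setT.

Definition random_element {R : realType} {d} {Om : measurableType d}
  {T : topologicalType} (X : Om -> T) : Prop :=
  forall A, borel A -> measurable (X @^-1` A).

Definition same_law {R : realType} {d d'} {Om : measurableType d}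
  {Om' : measurableType d'} (P : probability Om R) (P' : probability Om' R)
  {T : topologicalType} (X : Om -> T) (X' : Om' -> T) : Prop :=
  forall A, borel A -> P (X @^-1` A) = P' (X' @^-1` A).

Definition cvg_prob0 {R : realType} (d : nat -> measure_display)
  (Om : forall n, measurableType (d n)) (P : forall n, probability (Om n) R)
  (Z : forall n, Om n -> R) : Prop :=
  forall eps : R, 0 < eps ->
    (fun n => P n [set w | eps <= `|Z n w|]) @ \oo --> 0%E.

Definition couplings {R : realType} (S : nat -> completeNormedModType R)
  (dX dY : nat -> measure_display)
  (OX : forall n, measurableType (dX n)) (OY : forall n, measurableType (dY n))
  (PX : forall n, probability (OX n) R) (PY : forall n, probability (OY n) R)
  (X : forall n, OX n -> S n) (Y : forall n, OY n -> S n)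
  (d : nat -> measure_display) (Om : forall n, measurableType (d n))
  (P : forall n, probability (Om n) R)
  (X' Y' : forall n, Om n -> S n) : Prop :=
  forall n, [/\ random_element (R:=R) (X' n), random_element (R:=R) (Y' n),
    same_law (P n) (PX n) (X' n) (X n) & same_law (P n) (PY n) (Y' n) (Y n)].

Definition PL {R : realType} (S : normedModType R) (r : R) (f : S -> R) : Prop :=
  forall x y : S, `|f x - f y| <= `|x - y| * (1 + `|x| `^ (r - 1) + `|y| `^ (r - 1)).

Definition tight_norm {R : realType} (S : nat -> normedModType R)
  (d : nat -> measure_display) (Om : forall n, measurableType (d n))
  (P : forall n, probability (Om n) R) (X : forall n, Om n -> S n) : Prop :=
  (fun t : R => limn_esup (fun n => P n [set w | t <= `|X n w|])) @ +oo --> 0%E.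

(* Main.v *)
(* (i) and (ii) give (iii) for the same coupling: outside an event of small
   probability |X'| < t and |X' - Y'| < eta, where |f X' - f Y'| is at most
   eta (1 + 2 (t + 1)^(r-1)).

   In (iii) => (i) the coupling has to change: for independent uniform points on
   high-dimensional spheres every Lipschitz f concentrates, so f X' - f Y' tends
   to 0 while |X' - Y'| does not. Testing (iii) on the distances to sets A_n
   shows instead that the laws get close in the Prokhorov sense,
   P (X_n \in A) <= P (Y_n \in A^e) + e for all Borel A, eventually in n. Strassen's
   theorem then yields a good coupling: partition S_n into finitely many small
   cells up to a set of small mass, transport the cell masses along pairs of
   close cells by a weighted Hall theorem with defect, and inside a pair of
   cells take the product of the conditional laws. A diagonal choice of
   e = e_n -> 0 concludes. *)
Require Import Defs.
From HB Require Import structures.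
From mathcomp Require Import all_boot all_order all_algebra.
From mathcomp Require Import ring lra.
Set Implicit Arguments. Unset Strict Implicit. Unset Printing Implicit Defensive.
Import Order.TTheory GRing.Theory Num.Theory.
Local Open Scope ring_scope.

(** * Weighted Hall theorem with defect *)

Section finite_transport.
Variable R : realFieldType.

Definition nbr (I J : finType) (E : I -> J -> bool) (A : {set I}) : {set J} :=
  [set j | [exists i in A, E i j]].

Definition hall (I J : finType) (E : I -> J -> bool) (mu : I -> R) (nu : J -> R) :=
  forall A : {set I}, \sum_(i in A) mu i <= \sum_(j in nbr E A) nu j.

(** Rows are met exactly while columns are only capacities, because Hall's condition lets [nu] carry
    more total mass than [mu]. *)
Definition transports (I J : finType) (E : I -> J -> bool) (mu : I -> R)
    (nu : J -> R) (q : I -> J -> R) :=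
  [/\ forall i j, 0 <= q i j, forall i, \sum_j q i j = mu i,
      forall j, \sum_i q i j <= nu j & forall i j, ~~ E i j -> q i j = 0].

Lemma nbrU (I J : finType) (E : I -> J -> bool) (A B : {set I}) :
  nbr E (A :|: B) = nbr E A :|: nbr E B.
Proof.
apply/setP => j; rewrite !inE; apply/existsP/orP.
- move=> [i /andP[]]; rewrite inE => /orP[] iAB ij; [left|right];
  by apply/existsP; exists i; rewrite iAB.
- by move=> [] /existsP[i /andP[iAB ij]]; exists i; rewrite inE iAB ?orbT.
Qed.

Lemma sub_nbr (I J : finType) (E : I -> J -> bool) (A B : {set I}) :
  A \subset B -> nbr E A \subset nbr E B.
Proof.
move=> AB; apply/subsetP => j; rewrite !inE => /existsP[i /andP[iA ij]].
by apply/existsP; exists i; rewrite (subsetP AB).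
Qed.

Lemma sum_delta (I : finType) (A : pred I) (i : I) (t : R) :
  \sum_(k in A) (if k == i then t else 0) = if i \in A then t else 0.
Proof.
rewrite -big_mkcondr /=; case: ifPn => iA.
  by rewrite (big_pred1 i) // => k /=; rewrite andbC; case: eqP => //= ->.
by rewrite big_pred0 // => k /=; rewrite andbC; case: eqP => //= ->; rewrite (negbTE iA).
Qed.

Lemma le_sum_subset (I : finType) (mu : I -> R) (A B : {set I}) :
  (forall i, 0 <= mu i) -> A \subset B ->
  \sum_(i in A) mu i <= \sum_(i in B) mu i.
Proof.
move=> mu0 AB; rewrite big_mkcond [leRHS]big_mkcond /=; apply: ler_sum => i _.
by case: ifPn => [/(subsetP AB) ->//|_]; case: ifP.
Qed.

Lemma sum_setU_disjoint (I : finType) (mu : I -> R) (A B : {set I}) :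
  [disjoint A & B] ->
  \sum_(i in A :|: B) mu i = \sum_(i in A) mu i + \sum_(i in B) mu i.
Proof. by move=> AB; rewrite -bigU//=; apply: eq_bigl => i; rewrite !inE. Qed.

Lemma sum_setI (I : finType) (mu : I -> R) (A B : {set I}) :
  \sum_(i in A) (if i \in B then mu i else 0) = \sum_(i in A :&: B) mu i.
Proof. by rewrite -big_mkcondr; apply: eq_bigl => i; rewrite !inE. Qed.

(** The neighbours of [B :&: A] lie in both [nbr E B] and [nbr E A], so cutting [nu] down to
    [nbr E A] keeps all the mass they carry. *)
Lemma hall_restrict (I J : finType) (E : I -> J -> bool) (mu : I -> R) (nu : J -> R) (A : {set I}) :
  (forall j, 0 <= nu j) -> hall E mu nu ->
  hall E (fun i => if i \in A then mu i else 0)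
         (fun j => if j \in nbr E A then nu j else 0).
Proof.
move=> nu0 h B; rewrite !sum_setI; apply: (le_trans (h _)).
apply: le_sum_subset => //; rewrite subsetI !sub_nbr //; [exact: subsetIr|exact: subsetIl].
Qed.

(** Apply Hall's condition to [A] together with the part of [B] outside [A]. Tightness cancels the
    masses of [A] and [nbr E A], and what is left only counts neighbours outside [nbr E A]. *)
Lemma hall_restrict_compl (I J : finType) (E : I -> J -> bool) (mu : I -> R) (nu : J -> R) (A : {set I}) :
  (forall j, 0 <= nu j) -> hall E mu nu ->
  \sum_(i in A) mu i = \sum_(j in nbr E A) nu j ->
  hall E (fun i => if i \in ~: A then mu i else 0)
         (fun j => if j \in ~: nbr E A then nu j else 0).
Proof.
move=> nu0 h tA B; rewrite !sum_setI.
have := h (A :|: (B :&: ~: A)).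
rewrite nbrU sum_setU_disjoint; last first.
  by apply/pred0P => i /=; rewrite !inE; case: (i \in A); rewrite ?andbF.
rewrite -[nbr E A :|: _](_ : nbr E A :|: (nbr E (B :&: ~: A) :&: ~: nbr E A) = _); last first.
  by apply/setP => j; rewrite !in_setU in_setI in_setC; case: (j \in nbr E A); rewrite ?andbT.
rewrite sum_setU_disjoint; last first.
  apply/pred0P => i; rewrite /= in_setI in_setC.
  by case: (i \in nbr E A); rewrite ?andbF.
rewrite tA lerD2l => /le_trans; apply.
by apply: le_sum_subset => //; rewrite setSI// sub_nbr// subsetIl.
Qed.

(** A set containing [i] has [j] as a neighbour, so both of its sides lose [t]. Only a set that
    misses [i] and sees [j] loses slack, and the last hypothesis covers it. *)
Lemma hall_push (I J : finType) (E : I -> J -> bool) (mu : I -> R) (nu : J -> R) i j t :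
  0 <= t -> E i j -> hall E mu nu ->
  (forall A : {set I}, i \notin A -> j \in nbr E A ->
     t <= \sum_(j in nbr E A) nu j - \sum_(i in A) mu i) ->
  hall E (fun k => mu k - (if k == i then t else 0))
         (fun k => nu k - (if k == j then t else 0)).
Proof.
move=> t0 ij h ht A; rewrite !sumrB !sum_delta.
have hA := h A.
case: (boolP (i \in A)) => iA.
  rewrite (_ : j \in _) ?lerB //.
  by rewrite inE; apply/existsP; exists i; rewrite iA.
case: ifPn => jA; last by rewrite !subr0.
by have := ht A iA jA; lra.
Qed.

Lemma transports_push (I J : finType) (E : I -> J -> bool) (mu : I -> R) (nu : J -> R) i j t q :
  0 <= t -> E i j ->
  transports E (fun k => mu k - (if k == i then t else 0))
               (fun k => nu k - (if k == j then t else 0)) q ->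
  transports E mu nu (fun k l => q k l + (if (k == i) && (l == j) then t else 0)).
Proof.
move=> t0 ij [q0 qr qc qE]; split.
- by move=> k l; rewrite addr_ge0//; case: ifP.
- move=> k; rewrite big_split /= qr; case: eqP => _ /=.
    by rewrite (sum_delta predT) /= subrK.
  by rewrite big1 // subr0 addr0.
- move=> l; rewrite big_split /=; have := qc l.
  case: (l == j); last by rewrite [X in _ -> _ + X <= _]big1 ?subr0 ?addr0 // => k _; rewrite andbF.
  under [X in _ -> _ + X <= _]eq_bigr do rewrite andbT.
  by rewrite (sum_delta predT) /= lerBrDr.
- move=> k l kl; rewrite qE// add0r; case: ifP => // /andP[/eqP ki /eqP lj].
  by move: kl; rewrite ki lj ij.
Qed.

Lemma transports_add (I J : finType) (E : I -> J -> bool) (A : {set I})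
    (B : {set J}) (mu : I -> R) (nu : J -> R) q1 q2 :
  transports E (fun k => if k \in A then mu k else 0)
               (fun k => if k \in B then nu k else 0) q1 ->
  transports E (fun k => if k \in ~: A then mu k else 0)
               (fun k => if k \in ~: B then nu k else 0) q2 ->
  transports E mu nu (fun k l => q1 k l + q2 k l).
Proof.
move=> [a1 a2 a3 a4] [b1 b2 b3 b4]; split.
- by move=> k l; rewrite addr_ge0.
- move=> k; rewrite big_split /= a2 b2 in_setC.
  by case: (k \in A); rewrite ?addr0 ?add0r.
- move=> l; rewrite big_split /=; apply: (le_trans (lerD (a3 l) (b3 l))).
  by rewrite in_setC; case: (l \in B); rewrite ?addr0 ?add0r.
- by move=> k l kl; rewrite a4// b4// addr0.
Qed.

(* Push as much mass as possible along one edge (i, j): either a support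
   shrinks, or some set A avoiding i becomes tight and the problem splits into
   one on A and one on its complement, which respectively miss i and j. *)
Lemma hall_transports (I J : finType) (E : I -> J -> bool) (mu : I -> R) (nu : J -> R) :
  (forall i, 0 <= mu i) -> (forall j, 0 <= nu j) -> hall E mu nu ->
  exists q, transports E mu nu q.
Proof.
move: {2}(#|[set i | mu i != 0%R]| + #|[set j | nu j != 0%R]|)%N
  (leqnn (#|[set i | mu i != 0%R]| + #|[set j | nu j != 0%R]|)%N) => n.
elim: n mu nu => [|n IH] mu nu hn mu0 nu0 h.
  exists (fun _ _ => 0); split => //.
  - move=> i; rewrite big1//; apply/esym/eqP/negPn/negP => mui.
    move: hn; rewrite leqn0 addn_eq0 cards_eq0 => /andP[/eqP/setP/(_ i)].
    by rewrite !inE mui.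
  - by move=> j; rewrite big1.
have [/forallP mu00|] := boolP [forall i, mu i == 0].
  exists (fun _ _ => 0); split => //.
  - by move=> i; rewrite big1// (eqP (mu00 i)).
  - by move=> j; rewrite big1.
rewrite negb_forall => /existsP[i mui].
have {}mui : 0 < mu i by rewrite lt_neqAle eq_sym mui mu0.
have [j ij nuj] : exists2 j, E i j & 0 < nu j.
  have [/existsP[j /andP[ij nuj]]|/existsPn hj] := boolP [exists j, E i j && (nu j != 0)].
    by exists j => //; rewrite lt_neqAle eq_sym nuj nu0.
  have := h [set i]; rewrite big_set1 big1 ?leNgt ?mui // => j.
  rewrite inE => /existsP[k /andP[]]; rewrite inE => /eqP -> kj.
  by have := hj j; rewrite kj /= negbK => /eqP.
pose slack (A : {set I}) := \sum_(j in nbr E A) nu j - \sum_(i in A) mu i.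
pose P (A : {set I}) := (i \notin A) && (j \in nbr E A).
pose m := Num.min (mu i) (nu j).
have m0 : 0 < m by rewrite lt_min mui nuj.
have mmu : m <= mu i by rewrite ge_min lexx.
have mnu : m <= nu j by rewrite ge_min lexx orbT.
have push_ge0 (K : finType) (k : K) (w : K -> R) t : (forall l, 0 <= w l) -> t <= w k ->
    forall l, 0 <= w l - (if l == k then t else 0).
  by move=> w0 tw l; case: eqP => [->|_]; rewrite ?subr0 ?subr_ge0.
have push_supp (K : finType) (k : K) (w : K -> R) t : 0 < w k ->
    [set l | w l - (if l == k then t else 0) != 0] \subset [set l | w l != 0].
  move=> wk; apply/subsetP => l; rewrite !inE; have [->|_] := eqVneq l k; rewrite ?subr0 //.
  by rewrite (gt_eqF wk).
have push_supp_lt (K : finType) (k : K) (w : K -> R) : 0 < w k ->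
    (#|[set l | (w l - (if l == k then w k else 0) != 0)%R]| < #|[set l | w l != 0%R]|)%N.
  move=> wk; apply: proper_card; apply/properP; split; first exact: push_supp.
  by exists k; rewrite !inE ?eqxx ?subrr ?eqxx ?(gt_eqF wk).
have [/forallP hm|] := boolP [forall A, P A ==> (m <= slack A)].
  have h' : hall E (fun k => mu k - (if k == i then m else 0))
         (fun k => nu k - (if k == j then m else 0)).
    apply: hall_push => //; first exact: ltW.
    by move=> A iA jA; have := hm A; rewrite /P iA jA.
  have [|||q hq] := IH _ _ _ _ _ h'; last 1 first.
  - by exists (fun k l => q k l + (if (k == i) && (l == j) then m else 0));
      apply: transports_push => //; exact: ltW.
  - rewrite -ltnS; apply: leq_trans hn; rewrite /m; case: leP => _.
    + by rewrite -addSn leq_add ?push_supp_lt// subset_leq_card ?push_supp.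
    + by rewrite -addnS leq_add ?push_supp_lt// subset_leq_card ?push_supp.
  - exact: push_ge0.
  - exact: push_ge0.
rewrite negb_forall => /existsP[A0]; rewrite negb_imply -ltNge => /andP[PA0 sA0].
(* By minimality, pushing [t] respects Hall's condition, and it makes [A] tight. As [t < m], both
   [i] and [j] keep positive mass; hence the half on [A], which misses [i], and the half on the
   complement, which misses [j], have smaller supports. *)
case: (arg_minP slack PA0) => A PA minA; set t := slack A.
have tm : t < m by apply: le_lt_trans sA0; exact: minA.
have t0 : 0 <= t by rewrite subr_ge0; exact: h.
have tmu : t < mu i by exact: lt_le_trans tm mmu.
have tnu : t < nu j by exact: lt_le_trans tm mnu.
set mu' := (fun k => mu k - (if k == i then t else 0)).
set nu' := (fun k => nu k - (if k == j then t else 0)).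
have h' : hall E mu' nu'.
  by apply: hall_push => // B iB jB; apply: minA; rewrite /P iB jB.
have mu'0 : forall k, 0 <= mu' k by apply: push_ge0 => //; exact: ltW.
have nu'0 : forall k, 0 <= nu' k by apply: push_ge0 => //; exact: ltW.
have /andP[iA jA] := PA.
have tA : \sum_(i in A) mu' i = \sum_(j in nbr E A) nu' j.
  by rewrite !sumrB !sum_delta (negbTE iA) jA /t /slack; lra.
have supp_sub (K : finType) (B : {set K}) (w : K -> R) :
    [set l | (if l \in B then w l else 0) != 0] \subset [set l | w l != 0].
  by apply/subsetP => l; rewrite !inE; case: ifP => //; rewrite eqxx.
have supp_lt (K : finType) (k : K) (B : {set K}) (w : K -> R) : w k != 0 -> k \notin B ->
   (#|[set l | ((if l \in B then w l else 0) != 0)%R]| < #|[set l | w l != 0%R]|)%N.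
  move=> wk kB; apply: proper_card; apply/properP; split; first exact: supp_sub.
  by exists k; rewrite !inE ?wk// (negbTE kB) eqxx.
have mu'i : mu' i != 0 by rewrite /mu' eqxx subr_eq0 gt_eqF.
have nu'j : nu' j != 0 by rewrite /nu' eqxx subr_eq0 gt_eqF.
have hn' : (#|[set l | mu' l != 0%R]| + #|[set l | nu' l != 0%R]| <= n.+1)%N.
  by apply: leq_trans hn; apply: leq_add; apply: subset_leq_card; exact: push_supp.
have ge0_if (K : finType) (B : {set K}) (w : K -> R) : (forall l, 0 <= w l) ->
    forall l, 0 <= if l \in B then w l else 0.
  by move=> w0 l; case: ifP.
have [|||q1 hq1] := IH _ _ _ _ _ (hall_restrict A nu'0 h').
- rewrite -ltnS; apply: leq_trans hn'; rewrite -addSn leq_add//.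
    exact: supp_lt mu'i iA.
  by rewrite subset_leq_card// supp_sub.
- exact: ge0_if.
- exact: ge0_if.
have [|||q2 hq2] := IH _ _ _ _ _ (hall_restrict_compl nu'0 h' tA).
- rewrite -ltnS; apply: leq_trans hn'; rewrite -addnS leq_add//.
    by rewrite subset_leq_card// supp_sub.
  by apply: supp_lt nu'j _; rewrite in_setC negbK.
- exact: ge0_if.
- exact: ge0_if.
have hq := transports_add hq1 hq2.
by eexists; exact: transports_push t0 ij hq.
Qed.

(* The missing mass eps is sent to an extra column None; what this leaves
   unmatched is coupled independently. *)
Lemma defect_coupling (I J : finType) (E : I -> J -> bool) (mu : I -> R)
    (nu : J -> R) (eps : R) :
  0 <= eps -> (forall i, 0 <= mu i) -> (forall j, 0 <= nu j) ->
  \sum_i mu i = \sum_j nu j ->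
  (forall A : {set I}, \sum_(i in A) mu i <= \sum_(j in nbr E A) nu j + eps) ->
  exists q : I -> J -> R,
    [/\ forall i j, 0 <= q i j, forall i, \sum_j q i j = mu i,
        forall j, \sum_i q i j = nu j &
        \sum_i \sum_(j | ~~ E i j) q i j <= eps].
Proof.
move=> eps0 mu0 nu0 munu h.
pose E' (i : I) (j : option J) := if j is Some j then E i j else true.
pose nu' (j : option J) := if j is Some j then nu j else eps.
have sum_opt (F : option J -> R) : \sum_j F j = F None + \sum_j F (Some j).
  rewrite (bigD1 None) //=; congr (_ + _).
  rewrite (reindex_omap (Some : J -> option J) id) /=; last by case.
  by apply: eq_bigl => j; rewrite eqxx.
have nu'0 j : 0 <= nu' j by case: j.
have h' : hall E' mu nu'.
  (* The empty set does not see the column [None] and gains no [eps], so it is treated apart. *)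
  move=> A; have [->|/set0Pn[i0 i0A]] := eqVneq A set0.
    by rewrite big_set0 sumr_ge0.
  have nA : None \in nbr E' A by rewrite inE; apply/existsP; exists i0; rewrite i0A.
  rewrite [leRHS]big_mkcond sum_opt nA /=.
  rewrite addrC; apply: (le_trans (h A)); rewrite lerD2r big_mkcond /=.
  by apply: ler_sum => j _; rewrite !inE.
have [q [q0 qr qc qE]] := hall_transports mu0 nu'0 h'.
pose r i := q i None.
pose s j := nu j - \sum_i q i (Some j).
pose m := \sum_i r i.
have r0 i : 0 <= r i by exact: q0.
have s0 j : 0 <= s j by rewrite subr_ge0; exact: (qc (Some j)).
have sm : \sum_j s j = m.
  rewrite sumrB -munu exchange_big /= /m -sumrB; apply: eq_bigr => i _.
  by rewrite -qr sum_opt addrK.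
have meps : m <= eps by exact: (qc None).
have m0 : 0 <= m by apply: sumr_ge0.
(* If [m = 0] the quotient [m / m] is 0 instead of 1, but then every [r i] vanishes too, so the plan
   [r i * s j / m] needs no separate case. *)
have rm i : r i * (m / m) = r i.
  have [m00|mn0] := eqVneq m 0; last by rewrite divff ?mulr1.
  have /eqP : \sum_i r i = 0 by [].
  by rewrite psumr_eq0 // => /allP /(_ i (mem_index_enum _)) /eqP ->; rewrite mul0r.
have smm j : s j * (m / m) = s j.
  have [m00|mn0] := eqVneq m 0; last by rewrite divff ?mulr1.
  have /eqP : \sum_j s j = 0 by rewrite sm.
  by rewrite psumr_eq0 // => /allP /(_ j (mem_index_enum _)) /eqP ->; rewrite mul0r.
exists (fun i j => q i (Some j) + r i * s j / m); split.
- by move=> i j; rewrite addr_ge0 ?divr_ge0 ?mulr_ge0.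
- move=> i; rewrite big_split /= -mulr_suml -mulr_sumr sm -mulrA rm.
  by rewrite -qr sum_opt addrC.
- move=> j; rewrite big_split /= -mulr_suml -mulr_suml -/m [m * _]mulrC -mulrA smm.
  by rewrite /s addrC subrK.
- apply: (le_trans _ meps); apply: ler_sum => i _.
  rewrite (eq_bigr (fun j => r i * s j / m)); last first.
    by move=> j ij; rewrite (qE i (Some j)) ?add0r.
  rewrite -[leRHS]rm -{2}sm mulrA mulr_sumr mulr_suml.
  rewrite [leLHS]big_mkcond /=; apply: ler_sum => j _; case: ifP => // _.
  by rewrite divr_ge0 ?mulr_ge0.
Qed.

End finite_transport.

From mathcomp Require Import all_classical all_reals all_analysis.
From mathcomp Require Import measurable_realfun.
Import numFieldNormedType.Exports.
Local Open Scope classical_set_scope.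
Local Open Scope ring_scope.

(** * Couplings with prescribed cell masses *)

Lemma cvge0_near_lt (R : realType) (T : Type) (F : set_system T)
    (f : T -> \bar R) (e : R) :
  0 < e -> f @ F --> 0%E -> \forall x \near F, (f x < e%:E)%E.
Proof.
move=> e0 /(_ [set y | (y < e%:E)%E]); apply.
by apply: open_nbhs_nbhs; split; [exact: open_ereal_lt_ereal|rewrite /= lte_fin].
Qed.

Lemma near_le_cvge0 (R : realType) (u : (\bar R)^nat) :
  (forall n, (0 <= u n)%E) ->
  (forall e : R, 0 < e -> \forall n \near \oo, (u n <= e%:E)%E) ->
  u @ \oo --> 0%E.
Proof.
move=> u0 ue; apply: limn_esup_le_cvg => //; apply/lee_addgt0Pr => e e0; rewrite add0e.
have Ve := ue _ e0.
apply: (@le_trans _ _ (ereal_sup (u @` [set n | (u n <= e%:E)%E]))).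
  by apply: ereal_inf_lbound => /=; exists [set n | (u n <= e%:E)%E].
by apply: ge_ereal_sup => _ [n /= une <-].
Qed.

Lemma limn_esup_near_lt (R : realType) (u : (\bar R)^nat) (e : \bar R) :
  (limn_esup u < e)%E -> \forall n \near \oo, (u n < e)%E.
Proof.
move=> /ereal_inf_lt [_ /= [V VF <-] Ve].
apply: filterS VF => n Vn; apply: le_lt_trans Ve.
by apply: ereal_sup_ubound; exists n.
Qed.

Section finite_partition.
Context d (T : measurableType d) (R : realType).

Lemma measure_fibers (mu : {measure set T -> \bar R}) (I : finType) (c : T -> I)
    (A : set T) :
  (forall i, measurable (c @^-1` [set i])) -> measurable A ->
  mu A = (\sum_i mu (A `&` c @^-1` [set i]))%E.
Proof.
move=> mc mA.
have -> : (\sum_i mu (A `&` c @^-1` [set i]) =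
           \sum_(i \in [set: I]) mu (A `&` c @^-1` [set i]))%E.
  rewrite fsbig_seq ?index_enum_uniq //.
  rewrite (_ : [set` index_enum I] = setT) //.
  by apply/seteqP; split => i //= _; rewrite mem_index_enum.
rewrite -measure_fin_bigcup; [|exact: finite_finset| |].
- rewrite -setI_bigcupr; congr (mu _).
  by apply/seteqP; split => [x Ax|x []//]; split => //; exists (c x).
- by move=> i j _ _ [x [[_ <-] [_ <-]]].
- by move=> i _; exact: measurableI.
Qed.

Lemma exists_measure_sum (J : Type) (s : seq J) (m : J -> {measure set T -> \bar R}) :
  exists M : {measure set T -> \bar R}, forall A, M A = (\sum_(j <- s) m j A)%E.
Proof.
elim: s => [|j s [M HM]].
  by exists mzero => A; rewrite big_nil.
exists (measure_add (m j) M) => A.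
by rewrite big_cons -HM; exact: measure_addE.
Qed.

End finite_partition.

(** The coupling is the mixture, with weights [q i j], of the products of the conditional laws on
    the cells: [P1 \x P2] restricted to a pair of cells is rescaled by [q i j / (mu i * nu j)]. *)
Lemma discrete_coupling (R : realType) d1 d2 (T1 : measurableType d1)
    (T2 : measurableType d2) (P1 : probability T1 R) (P2 : probability T2 R)
    (I J : finType) (a : T1 -> I) (b : T2 -> J) (q : I -> J -> R) :
  (forall i, measurable (a @^-1` [set i])) ->
  (forall j, measurable (b @^-1` [set j])) ->
  (forall i j, 0 <= q i j) ->
  (forall i, \sum_j q i j = fine (P1 (a @^-1` [set i]))) ->
  (forall j, \sum_i q i j = fine (P2 (b @^-1` [set j]))) ->
  exists P : probability (T1 * T2)%type R,
    [/\ forall A, measurable A -> P (fst @^-1` A) = P1 A,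
        forall B, measurable B -> P (snd @^-1` B) = P2 B &
        forall i j, P ((a @^-1` [set i]) `*` (b @^-1` [set j])) = (q i j)%:E].
Proof.
move=> ma mb q0 qr qc.
pose mu i := fine (P1 (a @^-1` [set i])).
pose nu j := fine (P2 (b @^-1` [set j])).
have mu0 i : 0 <= mu i by apply: fine_ge0.
have nu0 i : 0 <= nu i by apply: fine_ge0.
pose c (k : I * J) := q k.1 k.2 / (mu k.1 * nu k.2).
have c0 k : 0 <= c k by rewrite divr_ge0 ?mulr_ge0.
have mab (k : I * J) : measurable ((a @^-1` [set k.1]) `*` (b @^-1` [set k.2])).
  exact: measurableX.
pose m (k : I * J) : {measure set (T1 * T2) -> \bar R} :=
  mscale (NngNum (c0 k)) (mrestr (P1 \x P2)%E (mab k)).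
have [M HM] := exists_measure_sum (index_enum (I * J)%type) m.
pose al A i := fine (P1 (A `&` a @^-1` [set i])).
pose be B j := fine (P2 (B `&` b @^-1` [set j])).
have MX A B : measurable A -> measurable B ->
    M (A `*` B) = (\sum_i \sum_j q i j / (mu i * nu j) * (al A i * be B j))%:E.
  move=> mA mB; rewrite HM pair_bigA /= -sumEFin; apply: eq_bigr => -[i j] _ /=.
  rewrite /mscale /= /mrestr -setXI product_measure1E; [|exact: measurableI..].
  rewrite [RHS]EFinM; congr (_ * _)%E.
  by rewrite EFinM /al /be !fineK ?fin_num_measure//; exact: measurableI.
have sum_al A : measurable A -> P1 A = (\sum_i al A i)%:E.
  move=> mA; rewrite (measure_fibers P1 ma mA) -sumEFin; apply: eq_bigr => i _.
  by rewrite /al fineK ?fin_num_measure//; exact: measurableI.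
have sum_be B : measurable B -> P2 B = (\sum_j be B j)%:E.
  move=> mB; rewrite (measure_fibers P2 mb mB) -sumEFin; apply: eq_bigr => i _.
  by rewrite /be fineK ?fin_num_measure//; exact: measurableI.
have alT i : al setT i = mu i by rewrite /al setTI.
have beT j : be setT j = nu j by rewrite /be setTI.
(* A cell of mass 0 makes the quotient 0, but its row of [q] vanishes as well. This and the three
   analogous facts below let the cell masses cancel in the marginals. *)
have q_mu i j : q i j * (mu i / mu i) = q i j.
  have [m0|mn0] := eqVneq (mu i) 0; last by rewrite divff ?mulr1.
  have /eqP : \sum_j q i j = 0 by rewrite qr.
  by rewrite psumr_eq0 // => /allP /(_ j (mem_index_enum _)) /eqP ->; rewrite mul0r.
have q_nu i j : q i j * (nu j / nu j) = q i j.
  have [m0|mn0] := eqVneq (nu j) 0; last by rewrite divff ?mulr1.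
  have /eqP : \sum_i q i j = 0 by rewrite qc.
  by rewrite psumr_eq0 // => /allP /(_ i (mem_index_enum _)) /eqP ->; rewrite mul0r.
have al_mu A i : measurable A -> al A i * (mu i / mu i) = al A i.
  move=> mA; have [m0|mn0] := eqVneq (mu i) 0; last by rewrite divff ?mulr1.
  suff -> : al A i = 0 by rewrite mul0r.
  apply/eqP; rewrite eq_le fine_ge0// andbT -m0 fine_le//.
  - by rewrite fin_num_measure//; exact: measurableI.
  - by rewrite fin_num_measure.
  - by apply: le_measure; rewrite ?inE//; exact: measurableI.
have be_nu B j : measurable B -> be B j * (nu j / nu j) = be B j.
  move=> mB; have [m0|mn0] := eqVneq (nu j) 0; last by rewrite divff ?mulr1.
  suff -> : be B j = 0 by rewrite mul0r.
  apply/eqP; rewrite eq_le fine_ge0// andbT -m0 fine_le//.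
  - by rewrite fin_num_measure//; exact: measurableI.
  - by rewrite fin_num_measure.
  - by apply: le_measure; rewrite ?inE//; exact: measurableI.
have M1 A : measurable A -> M (A `*` setT) = P1 A.
  move=> mA; rewrite MX // sum_al//; congr (_%:E); apply: eq_bigr => i _.
  transitivity (\sum_j (q i j * (nu j / nu j)) * (al A i / mu i)).
    by apply: eq_bigr => j _; rewrite beT invfM; ring.
  under eq_bigr do rewrite q_nu.
  by rewrite -mulr_suml qr -/(mu i) mulrCA al_mu.
have M2 B : measurable B -> M (setT `*` B) = P2 B.
  move=> mB; rewrite MX // sum_be//; congr (_%:E); rewrite exchange_big; apply: eq_bigr => j _.
  transitivity (\sum_i (q i j * (mu i / mu i)) * (be B j / nu j)).
    by apply: eq_bigr => i _; rewrite alT invfM; ring.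
  under eq_bigr do rewrite q_mu.
  by rewrite -mulr_suml qc -/(nu j) mulrCA be_nu.
have MT : M setT = 1%E by rewrite -setXTT M1// probability_setT.
(* [M] already has mass 1; normalizing keeps its values and supplies the probability structure. *)
pose P : probability (T1 * T2)%type R := mnormalize M (P1 \x P2)%E.
have PM A : P A = M A.
  rewrite /P /= /mnormalize MT /= onee_eq0 /=.
  by rewrite invr1 mule1.
exists P; split.
- by move=> A mA; rewrite PM -M1//; congr (M _); apply/seteqP; split => -[x y] //= [].
- by move=> B mB; rewrite PM -M2//; congr (M _); apply/seteqP; split => -[x y] //= [].
- move=> i j; rewrite PM MX //; congr (_%:E).
  have al_i k : al (a @^-1` [set i]) k = if k == i then mu i else 0.
    rewrite /al; case: eqP => [->|ki]; first by rewrite setIid.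
    rewrite (_ : _ `&` _ = set0) ?measure0//.
    by apply/seteqP; split => // x [/= -> /esym].
  have be_j k : be (b @^-1` [set j]) k = if k == j then nu j else 0.
    rewrite /be; case: eqP => [->|ki]; first by rewrite setIid.
    rewrite (_ : _ `&` _ = set0) ?measure0//.
    by apply/seteqP; split => // x [/= -> /esym].
  rewrite (bigD1 i) //= [X in _ + X]big1 ?addr0; last first.
    move=> k ki; rewrite big1 // => l _; rewrite al_i (negbTE ki); ring.
  rewrite (bigD1 j) //= [X in _ + X]big1 ?addr0; last first.
    move=> k kj; rewrite be_j (negbTE kj); ring.
  rewrite al_i be_j !eqxx invfM -{2}(q_mu i j) -{2}(q_nu i j); ring.
Qed.

(** * Random elements and pseudo-Lipschitz functions *)

Section random_elements.
Context {R : realType} {S : normedModType R}.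

Lemma separable_dense_seq : separable_space S ->
  exists x : nat -> S, forall y e, 0 < e -> exists k, `|y - x k| < e.
Proof.
move=> [D [/countable_injP[f finj] Dd]].
(* Indices that [f] does not reach from [D] receive the default point 0, which is harmless since
   density only asks for some [k]. *)
exists (fun k => xget 0 [set y | D y /\ f y = k]) => y e e0.
have : closure D y by rewrite Dd.
move=> /(_ (ball y e) (nbhsx_ballx y e e0)) [z [Dz yz]].
exists (f z); case: xgetP => [w _ [Dw fw]|/(_ z)]; last by case.
have -> : w = z by apply: finj; rewrite ?inE.
by move: yz; rewrite -ball_normE.
Qed.

Lemma borel_open (A : set S) : open A -> borel A.
Proof. exact: sub_sigma_algebra. Qed.

Lemma borel_closed (A : set S) : closed A -> borel A.
Proof.
move=> cA; rewrite -(setCK A) -setTD; apply: sigma_algebraCD.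
by apply: borel_open; exact: closed_openC.
Qed.

Lemma measurable_fun_continuous_random (d : measure_display)
    (Om : measurableType d) (X : Om -> S) (g : S -> R) :
  random_element (R := R) X -> continuous g -> measurable_fun setT (g \o X).
Proof.
move=> rX cg; apply: (measurability _ (RGenOInfty.measurableE R)).
move=> _ [_ [x ->] <-]; rewrite setTI comp_preimage; apply: rX; apply: borel_open.
by apply: open_comp => [y _|]; [exact: cg|exact: interval_open].
Qed.

(* Separability enters here: |x - y| is the supremum over a countable dense
   set of |x - z| - |y - z|, which is measurable term by term. *)
Lemma measurable_fun_norm_sub (d : measure_display)
    (Om : measurableType d) (X Y : Om -> S) :
  separable_space S -> random_element (R := R) X -> random_element (R := R) Y ->
  measurable_fun setT (fun w => `|X w - Y w|).
Proof.
move=> /separable_dense_seq[z zd] rX rY.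
apply: (measurability _ (RGenOInfty.measurableE R)).
move=> _ [_ [t ->] <-]; rewrite setTI.
have dist_cont k : continuous (fun x : S => `|x - z k|).
  by move=> x; apply: cvg_norm; apply: cvgB; [exact: cvg_id|exact: cvg_cst].
have mXY k : measurable_fun setT (fun w => `|X w - z k| - `|Y w - z k|).
  apply: measurable_funB.
    exact: (measurable_fun_continuous_random rX (dist_cont k)).
  exact: (measurable_fun_continuous_random rY (dist_cont k)).
rewrite (_ : _ @^-1` _ = \bigcup_k
    ((fun w => `|X w - z k| - `|Y w - z k|) @^-1` `]t, +oo[%classic)).
  apply: bigcupT_measurable => k; rewrite -[X in measurable X]setTI.
  exact: (mXY k).
apply/seteqP; split => w /=; rewrite in_itv /= andbT.
- move=> tw; have [k hk] := zd (Y w) ((`|X w - Y w| - t) / 2) ltac:(lra).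
  exists k => //=; rewrite in_itv /= andbT.
  by have := ler_distD (z k) (X w) (Y w); rewrite (distrC (z k)); lra.
- move=> [k _]; rewrite /= in_itv /= andbT => h.
  by have := ler_distD (Y w) (X w) (z k); lra.
Qed.

Lemma measurable_ge_set (d : measure_display) (Om : measurableType d)
    (g : Om -> R) (t : R) :
  measurable_fun setT g -> measurable [set w | t <= g w].
Proof.
move=> mg; rewrite (_ : [set _ | _] = setT `&` g @^-1` `[t, +oo[%classic).
  by apply: mg.
by rewrite setTI; apply/seteqP; split => w /=; rewrite in_itv /= andbT.
Qed.

(** Within distance 1 of [x] the growth factor is at most the constant [C]. Continuity is what makes
    [f] of a random element measurable. *)
Lemma PL_continuous (r : R) (f : S -> R) : 1 <= r -> PL r f -> continuous f.
Proof.
move=> r1 fPL x; apply/cvgrPdist_lt => e e0.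
pose C := 1 + 2 * (`|x| + 1) `^ (r - 1).
have C0 : 0 < C by rewrite /C; have := powR_ge0 (`|x| + 1) (r - 1); lra.
near=> y.
have xy1 : `|x - y| < 1 by near: y; exact: cvgr_dist_lt.
have xye : `|x - y| < e / C.
  by near: y; apply: cvgr_dist_lt => //; exact: divr_gt0.
have yx : `|y| <= `|x| + 1.
  have := ler_normD x (y - x); rewrite addrC subrK distrC; lra.
have pw (z : S) : `|z| <= `|x| + 1 -> `|z| `^ (r - 1) <= (`|x| + 1) `^ (r - 1).
  by move=> zx; apply: ge0_ler_powR; rewrite ?nnegrE ?subr_ge0 ?addr_ge0.
apply: (le_lt_trans (fPL x y)).
apply: (@le_lt_trans _ _ (`|x - y| * C)).
  apply: ler_wpM2l => //; rewrite /C.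
  have := pw x; have := pw y yx; rewrite lerDl ler01 => ? /(_ isT); lra.
by rewrite -ltr_pdivlMr.
Unshelve. all: by end_near. Qed.

(** Only [x] is assumed bounded: [eta <= 1] puts [y] in the ball of radius [t + 1]. This is why (ii)
    may concern just one of the two sequences. *)
Lemma PL_diff_le (r : R) (f : S -> R) (x y : S) (t eta : R) :
  1 <= r -> PL r f -> eta <= 1 -> `|x| < t -> `|x - y| < eta ->
  `|f x - f y| <= eta * (1 + 2 * (t + 1) `^ (r - 1)).
Proof.
move=> r1 fPL eta1 xt xy.
have yx : `|y| <= t + 1.
  have := ler_normD x (y - x); rewrite addrC subrK distrC; lra.
have pw (z : S) : `|z| <= t + 1 -> `|z| `^ (r - 1) <= (t + 1) `^ (r - 1).
  move=> zt; apply: ge0_ler_powR; rewrite ?nnegrE ?subr_ge0 //.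
  by apply: le_trans zt.
apply: (le_trans (fPL x y)); apply: ler_pM => //.
- by have := powR_ge0 `|x| (r - 1); have := powR_ge0 `|y| (r - 1); lra.
- by have := pw x; have := pw y yx; move=> ? /(_ ltac:(lra)); lra.
Qed.

Lemma prob_PL_diff_le (d : measure_display) (Om : measurableType d)
    (P : probability Om R) (X Y : Om -> S) (r : R) (f : S -> R) (t eta eps : R) :
  separable_space S -> random_element (R := R) X -> random_element (R := R) Y ->
  1 <= r -> PL r f -> eta <= 1 -> eta * (1 + 2 * (t + 1) `^ (r - 1)) < eps ->
  (P [set w | (eps <= `|f (X w) - f (Y w)|)%R] <=
   P [set w | (t <= `|X w|)%R] + P [set w | (eta <= `|X w - Y w|)%R])%E.
Proof.
move=> sepS rX rY r1 fPL eta1 heps.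
have cf := PL_continuous r1 fPL.
have m1 : measurable [set w | t <= `|X w|].
  apply: (@measurable_ge_set _ _ (fun w => `|X w|)).
  apply: (measurable_fun_continuous_random (g := fun x : S => `|x|) rX).
  exact: norm_continuous.
have m2 : measurable [set w | eta <= `|X w - Y w|].
  by apply: measurable_ge_set; exact: measurable_fun_norm_sub.
have m3 : measurable [set w | eps <= `|f (X w) - f (Y w)|].
  apply: measurable_ge_set; apply: measurableT_comp => //.
  by apply: measurable_funB; exact: (measurable_fun_continuous_random _ cf).
apply: le_trans (measureU2 P m1 m2).
apply: le_measure; rewrite ?inE //; first exact: measurableU.
move=> w /= epsw; have [tX|Xt] := leP t `|X w|; [by left|right].
rewrite leNgt; apply/negP => XY.
by move: epsw; rewrite leNgt (le_lt_trans _ heps)// PL_diff_le.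
Qed.

End random_elements.

(** * Tightness and pseudo-Lipschitz images of close couplings *)

Lemma same_law_norm_ge (R : realType) (S : normedModType R) d d'
    (Om : measurableType d) (Om' : measurableType d') (P : probability Om R)
    (P' : probability Om' R) (X : Om -> S) (X' : Om' -> S) (t : R) :
  same_law P P' X X' ->
  P [set w | t <= `|X w|] = P' [set w | t <= `|X' w|].
Proof.
move=> /(_ [set x : S | t <= `|x|]); apply; apply: borel_closed.
have := @preimage_closed _ _ (fun x : S => `|x|) [set u : R | t <= u].
by apply; [move=> x _; exact: norm_continuous|exact: closed_ge].
Qed.

Section tightness.
Context {R : realType} (S : nat -> completeNormedModType R)
  (d : nat -> measure_display) (Om : forall n, measurableType (d n))
  (P : forall n, probability (Om n) R).
Hypothesis sepS : forall n, separable_space (S n).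

(** Carries (ii) from the given sequence over to its coupled copy, as one threshold [t] for each
    [e], valid for all large [n]. *)
Lemma tight_norm_same_law (d' : nat -> measure_display)
    (Om' : forall n, measurableType (d' n)) (P' : forall n, probability (Om' n) R)
    (X : forall n, Om n -> S n) (X' : forall n, Om' n -> S n) :
  (forall n, same_law (P n) (P' n) (X n) (X' n)) ->
  tight_norm P' X' -> forall e : R, 0 < e ->
  exists t : R, \forall n \near \oo, (P n [set w | (t <= `|X n w|)%R] < e%:E)%E.
Proof.
move=> law tX e e0.
have [M [_ /(_ (M + 1))]] := cvge0_near_lt e0 tX.
rewrite ltrDl ltr01 => /(_ isT) /limn_esup_near_lt Mn.
by exists (M + 1); apply: filterS Mn => n; rewrite (same_law_norm_ge _ (law n)).
Qed.

Lemma cvg_prob0_PL (X Y : forall n, Om n -> S n) (r : R) (f : forall n, S n -> R) :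
  (forall n, random_element (R := R) (X n)) ->
  (forall n, random_element (R := R) (Y n)) ->
  (forall e : R, 0 < e ->
    exists t : R, \forall n \near \oo, (P n [set w | (t <= `|X n w|)%R] < e%:E)%E) ->
  cvg_prob0 P (fun n w => `|X n w - Y n w|) ->
  1 <= r -> (forall n, PL r (f n)) ->
  cvg_prob0 P (fun n w => f n (X n w) - f n (Y n w)).
Proof.
move=> rX rY tX XY r1 fPL eps eps0; apply: near_le_cvge0 => [n|e e0].
  exact: measure_ge0.
have [t tn] := tX (e / 2) ltac:(lra).
pose C := 1 + 2 * (t + 1) `^ (r - 1).
have C0 : 0 < C by rewrite /C; have := powR_ge0 (t + 1) (r - 1); lra.
(* The bound 1 keeps the second element within [t + 1]; the bound [eps / 2 / C] gives the strict
   inequality [eta * C < eps]. *)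
pose eta := Num.min 1 (eps / 2 / C).
have eta0 : 0 < eta by rewrite lt_min ltr01 /= !divr_gt0.
have etaC : eta * C < eps.
  apply: (@le_lt_trans _ _ (eps / 2)); last by lra.
  by rewrite -ler_pdivlMr// ge_min lexx orbT.
have etan := cvge0_near_lt (ltac:(lra) : 0 < e / 2) (XY _ eta0).
near=> n.
apply: (le_trans (prob_PL_diff_le (P n) (sepS n) (rX n) (rY n) r1 (fPL n) _ etaC)).
  by rewrite ge_min lexx.
rewrite (splitr e) EFinD; apply: leeD; apply: ltW; first by near: n.
under eq_set do rewrite -[in X in _ <= X]normr_id.
by near: n.
Unshelve. all: by end_near. Qed.

End tightness.

(** * Strassen's theorem *)

Section enlargement.
Context {R : realType} {S : normedModType R}.

(** The strict inequality makes the enlargement open, hence Borel, whatever [A] is. *)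
Definition enlargement (A : set S) (e : R) : set S :=
  [set y | exists2 x, A x & `|x - y| < e].

Lemma open_enlargement (A : set S) (e : R) : open (enlargement A e).
Proof.
rewrite (_ : enlargement A e = \bigcup_(x in A) ball x e).
  by apply: bigcup_open => x _; exact: ball_open.
by apply/seteqP; split => y [x Ax xy]; exists x => //; move: xy; rewrite -ball_normE.
Qed.

Definition dist_to (A : set S) (x : S) : R := inf [set `|x - a| | a in A].

Lemma dist_to_has_lbound (A : set S) x : has_lbound [set `|x - a| | a in A].
Proof. by exists 0 => _ [a _ <-]. Qed.

Lemma dist_to_le (A : set S) x y : dist_to A x - dist_to A y <= `|x - y|.
Proof.
have [->|/set0P[a0 Aa0]] := eqVneq A set0.
  by rewrite /dist_to !image_set0 !inf0 subrr.
rewrite lerBlDr -lerBlDl; apply: lb_le_inf; first by exists `|y - a0|, a0.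
move=> _ [a Aa <-]; rewrite lerBlDl.
apply: (@le_trans _ _ `|x - a|); first by apply: (ge_inf (dist_to_has_lbound A x)); exists a.
exact: ler_distD.
Qed.

(** At [r = 1] both powers are 1, so the class consists of the 3-Lipschitz functions, and
    [dist_to A] is 1-Lipschitz. For empty [A] it is constantly 0, the infimum of the empty set. *)
Lemma PL_dist_to (A : set S) : PL 1 (dist_to A).
Proof.
move=> x y; rewrite subrr !powRr0; apply: (@le_trans _ _ `|x - y|).
  by rewrite ler_norml dist_to_le andbT lerNl opprB distrC dist_to_le.
by apply: ler_peMr => //; lra.
Qed.

Lemma dist_to_in (A : set S) x : A x -> dist_to A x = 0.
Proof.
move=> Ax; apply/eqP; rewrite eq_le; apply/andP; split.
  by apply: (ge_inf (dist_to_has_lbound A x)); exists x => //; rewrite subrr normr0.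
by apply: lb_le_inf => [|_ [a _ <-]//]; exists `|x - x|, x.
Qed.

Lemma dist_to_notin_enlargement (A : set S) e y :
  A !=set0 -> ~ enlargement A e y -> e <= dist_to A y.
Proof.
move=> [a0 Aa0] yA; apply: lb_le_inf; first by exists `|y - a0|, a0.
move=> _ [a Aa <-]; rewrite leNgt; apply/negP => ya; apply: yA.
by exists a => //; rewrite distrC.
Qed.

End enlargement.

(** Half of the condition defining the Prokhorov distance; applied to complements of enlargements it
    yields the other half. *)
Definition prokhorov_le {R : realType} {S : normedModType R} {d1 d2}
  {T1 : measurableType d1} {T2 : measurableType d2} (P1 : probability T1 R)
  (P2 : probability T2 R) (X : T1 -> S) (Y : T2 -> S) (e : R) : Prop :=
  forall A, borel A ->
    (P1 (X @^-1` A) <= P2 (Y @^-1` enlargement A e) + e%:E)%E.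

(* If the inequality fails for A n, test the hypothesis on the distance to A n. *)
Lemma near_prokhorov_le (R : realType) (S : nat -> completeNormedModType R)
    (dX dY : nat -> measure_display)
    (OX : forall n, measurableType (dX n)) (OY : forall n, measurableType (dY n))
    (PX : forall n, probability (OX n) R) (PY : forall n, probability (OY n) R)
    (X : forall n, OX n -> S n) (Y : forall n, OY n -> S n)
    (d : nat -> measure_display) (Om : forall n, measurableType (d n))
    (P : forall n, probability (Om n) R) (X' Y' : forall n, Om n -> S n) :
  couplings PX PY X Y P X' Y' ->
  (forall f : forall n, S n -> R, (forall n, PL 1 (f n)) ->
     cvg_prob0 P (fun n w => f n (X' n w) - f n (Y' n w))) ->
  forall e, 0 < e -> \forall n \near \oo, prokhorov_le (PX n) (PY n) (X n) (Y n) e.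
Proof.
move=> XY hPL e e0.
pose fails n (A : set (S n)) := borel A /\
  ~ (PX n (X n @^-1` A) <= PY n (Y n @^-1` enlargement A e) + e%:E)%E.
(* One sequence of test sets decides all Borel sets at once: [A n] is a failing set whenever there
   is one at [n], and empty otherwise. *)
pose A n : set (S n) := xget set0 [set A | fails n A].
have := cvge0_near_lt e0 (hPL (fun n => dist_to (A n)) (fun n => PL_dist_to (A n)) e e0).
apply: filterS => n Pn A0 bA0; apply: contrapT => nA0.
have [bA] : fails n (A n) by rewrite /A; case: xgetP => [B -> //|/(_ A0)[]].
have [rX rY lX lY] := XY n.
have mA : measurable (X' n @^-1` A n) by exact: rX.
have bE : borel (enlargement (A n) e) by apply: borel_open; exact: open_enlargement.
have mE : measurable (Y' n @^-1` enlargement (A n) e) by exact: rY.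
have r11 : (1 : R) <= 1 by [].
have cf := PL_continuous r11 (PL_dist_to (A n)).
have mD : measurable [set w | e <= `|dist_to (A n) (X' n w) - dist_to (A n) (Y' n w)|].
  apply: measurable_ge_set; apply: measurableT_comp => //.
  by apply: measurable_funB; exact: (measurable_fun_continuous_random _ cf).
apply; rewrite -lX // -lY //.
apply: (@le_trans _ _ (P n (Y' n @^-1` enlargement (A n) e) +
    P n [set w | (e <= `|dist_to (A n) (X' n w) - dist_to (A n) (Y' n w)|)%R])%E);
  last by apply: leeD => //; exact: ltW.
apply: le_trans (measureU2 (P n) mE mD).
apply: le_measure; rewrite ?inE //; first exact: measurableU.
(* If [X'] lies in [A n] and [Y'] outside its enlargement, the distance to [A n] is 0 at [X'] and at
   least [e] at [Y']. *)
move=> w /= Aw; have [?|nE] := pselect (enlargement (A n) e (Y' n w)); [by left|right].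
rewrite /= (dist_to_in Aw) sub0r normrN.
apply: (le_trans (dist_to_notin_enlargement _ nE)); last exact: ler_norm.
by exists (X' n w).
Qed.

(** * Discretization into finitely many Borel cells *)

Lemma measurable_find d (T : measurableType d) (p : nat -> T -> bool) (s : seq nat) k :
  (forall j, measurable [set w | p j w]) ->
  measurable [set w | find (p ^~ w) s = k].
Proof.
move=> mp; elim: s k => [|j s IH] k /=.
  have [->|k0] := eqVneq k 0%N.
    by rewrite (_ : [set _ | _] = setT) //; apply/seteqP.
  rewrite (_ : [set _ | _] = set0) //.
  by apply/seteqP; split => // w /= /esym/eqP; rewrite (negbTE k0).
case: k => [|k].
  rewrite (_ : [set _ | _] = [set w | p j w]) //.
  by apply/seteqP; split => w /=; case: (p j w).
rewrite (_ : [set _ | _] = ~` [set w | p j w] `&` [set w | find (p ^~ w) s = k]).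
  by apply: measurableI; [exact: measurableC|exact: IH].
apply/seteqP; split => w /=; case: (p j w) => //.
- by move=> [].
- by move=> [].
- by move=> [_ ->].
Qed.

Section fibers.
Context d (T : measurableType d) (R : realType) (I : finType) (c : T -> I).
Hypothesis mc : forall i, measurable (c @^-1` [set i]).

Lemma measurable_fibers_in (A : {set I}) : measurable [set w | c w \in A].
Proof.
rewrite (_ : [set _ | _] = \bigcup_(i in [set i | i \in A]) (c @^-1` [set i])).
  by apply: fin_bigcup_measurable => // ; exact: finite_finset.
by apply/seteqP; split => [w wA|w [i iA /= ->]] //; exists (c w).
Qed.

Lemma measure_fibers_in (P : probability T R) (A : {set I}) :
  P [set w | c w \in A] = (\sum_(i in A) fine (P (c @^-1` [set i])))%:E.
Proof.
rewrite (measure_fibers P mc (measurable_fibers_in A)) -sumEFin big_mkcond /=.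
rewrite [RHS]big_mkcond; apply: eq_bigr => i _; case: ifPn => iA.
  rewrite fineK ?fin_num_measure //; congr (P _).
  by apply/seteqP; split => [w []//|w /= wi]; rewrite wi.
rewrite (_ : _ `&` _ = set0) ?measure0 //.
by apply/seteqP; split => // w [/= + wi]; rewrite wi (negbTE iA).
Qed.

Lemma sum_prob_fibers (P : probability T R) :
  \sum_i fine (P (c @^-1` [set i])) = 1.
Proof.
apply: EFin_inj; rewrite -sumEFin -(probability_setT P) (measure_fibers P mc) //.
by apply: eq_bigr => i _; rewrite setTI fineK ?fin_num_measure.
Qed.

End fibers.

Section strassen.
Context {R : realType} {S : normedModType R} {d1 d2 : measure_display}
  {T1 : measurableType d1} {T2 : measurableType d2}
  (P1 : probability T1 R) (P2 : probability T2 R) (X : T1 -> S) (Y : T2 -> S).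
Hypothesis sepS : separable_space S.
Hypothesis rX : random_element (R := R) X.
Hypothesis rY : random_element (R := R) Y.

Lemma measurable_uncovered d (T : measurableType d)
    (Z : T -> S) (x : nat -> S) (e : R) (N : nat) :
  random_element (R := R) Z ->
  measurable [set w | forall k, (k < N)%N -> e <= `|Z w - x k|].
Proof.
move=> rZ.
have dist_cont k : continuous (fun y : S => `|y - x k|).
  by move=> y; apply: cvg_norm; apply: cvgB; [exact: cvg_id|exact: cvg_cst].
rewrite (_ : [set _ | _] =
    \bigcap_(k in [set k | (k < N)%N]) [set w | e <= `|Z w - x k|]).
  apply: bigcap_measurableType => k _; apply: measurable_ge_set.
  exact: (measurable_fun_continuous_random rZ (dist_cont k)).
by apply/seteqP; split => w Fw k /=; exact: Fw.
Qed.

(** Every point is covered by some ball, so these events decrease to the empty set and continuity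
    from above applies. This takes the place of a compactness argument. *)
Lemma near_uncovered_lt d (T : measurableType d) (P : probability T R)
    (Z : T -> S) (x : nat -> S) (e : R) :
  random_element (R := R) Z -> (forall y, exists k, `|y - x k| < e) -> 0 < e ->
  \forall N \near \oo,
    (P [set w | forall k, (k < N)%N -> (e <= `|Z w - x k|)%R] < e%:E)%E.
Proof.
move=> rZ xd e0; apply: cvge0_near_lt => //.
pose F N := [set w | forall k, (k < N)%N -> e <= `|Z w - x k|].
have mF N : measurable (F N) by exact: measurable_uncovered.
have F0 : \bigcap_n F n = set0.
  apply/seteqP; split => // w Fw; have [k hk] := xd (Z w).
  by have := Fw k.+1 I k (ltnSn k); rewrite leNgt hk.
rewrite -(measure0 P) -F0; apply: nonincreasing_cvg_mu => //.
- by rewrite ltey_eq fin_num_measure//; exact: (mF 0%N).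
- exact: bigcapT_measurable.
- move=> m n mn; apply/subsetPset => w Fn k km; apply: Fn.
  exact: leq_trans km mn.
Qed.

(* Discretize along the cells "first k < N with |y - x k| < e", the last index
   collecting the uncovered part, and couple the cells by defect_coupling; the
   three units of loss are the two uncovered parts and the Prokhorov defect. *)
Lemma strassen_coupling (e : R) : 0 < e -> prokhorov_le P1 P2 X Y e ->
  exists P : probability (T1 * T2)%type R,
    [/\ forall A, measurable A -> P (fst @^-1` A) = P1 A,
        forall B, measurable B -> P (snd @^-1` B) = P2 B &
        (P [set w | (5 * e <= `|X w.1 - Y w.2|)%R] <= (3 * e)%:E)%E].
Proof.
move=> e0 PXY.
have [x xd] := separable_dense_seq sepS.
have xe y : exists k, `|y - x k| < e by exact: xd.
have [N [N1 N2]] : exists N : nat,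
    (P1 [set w | forall k, (k < N)%N -> (e <= `|X w - x k|)%R] < e%:E)%E /\
    (P2 [set w | forall k, (k < N)%N -> (e <= `|Y w - x k|)%R] < e%:E)%E.
  near \oo => N; exists N; split; near: N; exact: near_uncovered_lt.
pose idx (y : S) := find (fun k => `|y - x k| < e) (iota 0 N).
have idxN y : (idx y <= N)%N by rewrite -[leqRHS](size_iota 0 N) find_size.
have idx_lt y : (idx y < N)%N -> `|y - x (idx y)| < e.
  move=> yN; have /(nth_find 0%N) : has (fun k => `|y - x k| < e) (iota 0 N).
    by rewrite has_find size_iota.
  by rewrite nth_iota.
have idx_eq y : idx y = N -> forall k, (k < N)%N -> e <= `|y - x k|.
  move=> yN k kN; rewrite leNgt; apply/negP => yk.
  suff : (idx y < N)%N by rewrite yN ltnn.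
  rewrite -[leqRHS](size_iota 0 N) -has_find; apply/hasP; exists k => //.
  by rewrite mem_iota.
pose cell y : 'I_N.+1 := inord (idx y).
have cellE y : cell y = idx y :> nat by rewrite inordK // ltnS.
have bcell i : borel (cell @^-1` [set i]).
  (* Viewing [S] with its Borel sets as a measurable space lets [measurable_find] apply. [find]
     returns [N] when no centre is close, so the uncovered cell is included. *)
  have mp j : @measurable _ (g_sigma_algebraType (@open S)) [set y : S | `|y - x j| < e].
    rewrite (_ : [set _ | _] = ball (x j) e); first by apply: sub_sigma_algebra; exact: ball_open.
    by rewrite -ball_normE; apply/seteqP; split => y /=; rewrite distrC.
  have := @measurable_find _ (g_sigma_algebraType (@open S)) _ (iota 0 N) i mp.
  rewrite (_ : [set _ | _] = cell @^-1` [set i]) //.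
  apply/seteqP; split => y /=; last by move=> <-; rewrite cellE.
  by move=> yi; apply/val_inj; rewrite /= cellE.
pose a := cell \o X; pose b := cell \o Y.
have ma i : measurable (a @^-1` [set i]) by rewrite comp_preimage; exact: rX.
have mb i : measurable (b @^-1` [set i]) by rewrite comp_preimage; exact: rY.
(* The index [ord_max] is the uncovered cell; it gets no edges because its points share no nearby
   centre. *)
pose E (i j : 'I_N.+1) := [&& i != ord_max, j != ord_max &
  `[< exists y z, [/\ cell y = i, cell z = j & `|y - z| < e] >]].
pose mu i := fine (P1 (a @^-1` [set i])).
pose nu j := fine (P2 (b @^-1` [set j])).
have uncovered y : cell y = ord_max -> forall k, (k < N)%N -> e <= `|y - x k|.
  by move=> ym; apply: idx_eq; rewrite -cellE ym.
have mu_max : mu ord_max <= e.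
  rewrite -lee_fin fineK ?fin_num_measure //; apply: le_trans (ltW N1).
  apply: le_measure; rewrite ?inE //; first exact: measurable_uncovered.
  by move=> w; exact: uncovered.
have nu_max : nu ord_max <= e.
  rewrite -lee_fin fineK ?fin_num_measure //; apply: le_trans (ltW N2).
  apply: le_measure; rewrite ?inE //; first exact: measurable_uncovered.
  by move=> w; exact: uncovered.
have hall_defect (A : {set 'I_N.+1}) :
    \sum_(i in A) mu i <= \sum_(j in nbr E A) nu j + 3 * e.
  (* Removing the uncovered cell from [A] costs at most [mu ord_max <= e] and leaves only cells of
     small diameter. *)
  pose U : set S := [set y | cell y \in A :\ ord_max].
  have bU : borel U.
    exact: (@measurable_fibers_in _ (g_sigma_algebraType (@open S))).
  apply: (@le_trans _ _ (\sum_(i in A :\ ord_max) mu i + e)).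
    apply: (@le_trans _ _ (\sum_(i in ord_max |: (A :\ ord_max)) mu i)).
      apply: le_sum_subset; first by move=> i; exact: fine_ge0.
      by apply/fintype.subsetP => i iA; rewrite !inE iA andbT orbN.
    by rewrite big_setU1 /= ?inE ?eqxx // addrC lerD2l.
  rewrite -lee_fin EFinD -measure_fibers_in //.
  apply: (@le_trans _ _ (P2 (Y @^-1` enlargement U e) + e%:E + e%:E)%E).
    by rewrite leeD2r//; exact: PXY.
  have nu_le : (P2 (Y @^-1` enlargement U e) <=
      (\sum_(j in nbr E A) nu j + nu ord_max)%:E)%E.
    rewrite EFinD -measure_fibers_in // fineK ?fin_num_measure //.
    apply: (le_trans _ (measureU2 P2 (measurable_fibers_in mb (nbr E A)) (mb ord_max))).
    apply: le_measure; rewrite ?inE.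
    - by apply: rY; apply: borel_open; exact: open_enlargement.
    - by apply: measurableU => //; exact: measurable_fibers_in.
    (* A point within [e] of [U] is either uncovered or in a cell joined by [E] to a cell of [A],
       with [y] and [Y w] as the witnessing pair. *)
    move=> w [y yU yw] /=; have [bm|bm] := eqVneq (b w) ord_max; [by right|left].
    rewrite inE; apply/existsP; exists (cell y).
    move: yU; rewrite /U /= !inE => /andP[ym ->] /=.
    by rewrite /E ym bm /=; apply/asboolP; exists y, (Y w).
  apply: (le_trans (leeD2r _ (leeD2r _ nu_le))).
  by rewrite -!EFinD lee_fin; lra.
have [||||q [q0 qr qc qE]] := @defect_coupling R _ _ E mu nu (3 * e) _ _ _ _ hall_defect.
- by lra.
- by move=> i; exact: fine_ge0.
- by move=> i; exact: fine_ge0.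
- by rewrite !sum_prob_fibers.
have [P [PX PY Pq]] := discrete_coupling ma mb q0 qr qc.
exists P; split => //.
pose c (w : T1 * T2) := (a w.1, b w.2).
have mc k : measurable (c @^-1` [set k]).
  rewrite (_ : _ @^-1` _ = (a @^-1` [set k.1]) `*` (b @^-1` [set k.2])).
    exact: measurableX.
  by case: k => i j; apply/seteqP; split => w [ai bj]; [split|congr pair].
pose bad : {set 'I_N.+1 * 'I_N.+1} := [set k | ~~ E k.1 k.2]%SET.
apply: (@le_trans _ _ (P [set w | c w \in bad])).
  apply: le_measure; rewrite ?inE.
  - apply: (@measurable_ge_set _ _ _ (fun w => `|X w.1 - Y w.2|)).
    apply: (measurable_fun_norm_sub (X := X \o fst) (Y := Y \o snd) sepS).
      move=> A bA; rewrite comp_preimage -[X in measurable X]setTI.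
      by apply: measurable_fst => //; exact: rX.
    move=> A bA; rewrite comp_preimage -[X in measurable X]setTI.
    by apply: measurable_snd => //; exact: rY.
  - exact: measurable_fibers_in.
  move=> w /= XYw; rewrite inE; apply/negP => /and3P[am bm /asboolP[y [z [ya zb yz]]]].
  have lt_max (i : 'I_N.+1) : i != ord_max -> (i < N)%N.
    by move=> im; rewrite ltn_neqAle -ltnS ltn_ord andbT.
  have near_center u i : i != ord_max -> cell u = i -> `|u - x i| < e.
    by move=> /lt_max iN ui; rewrite -ui cellE; apply: idx_lt; rewrite -cellE ui.
  (* The factor 5: the chain [X w.1], [x i], [y], [z], [x j], [Y w.2] has five links, each shorter
     than [e]. *)
  have := near_center (X w.1) _ am erefl; have := near_center (Y w.2) _ bm erefl.
  have := near_center y _ am ya; have := near_center z _ bm zb.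
  set i := a w.1; set j := b w.2 => h1 h2 h3 h4.
  have := ler_distD (x i) (X w.1) (Y w.2); have := ler_distD y (x i) (Y w.2).
  have := ler_distD z y (Y w.2); have := ler_distD (x j) z (Y w.2).
  rewrite (distrC (x i) y) (distrC (x j) (Y w.2)); lra.
rewrite measure_fibers_in // lee_fin; apply: le_trans qE.
rewrite pair_big_dep /= le_eqVlt; apply/orP; left; apply/eqP.
apply: eq_big => [k|[i j] _]; first by rewrite inE.
rewrite (_ : c @^-1` _ = (a @^-1` [set i]) `*` (b @^-1` [set j])) ?Pq //.
by apply/seteqP; split => w [ai bj]; [split|congr pair].
Unshelve. all: by end_near. Qed.

End strassen.

(* At stage n use the best level 1/(k+1), k <= n, at which the Prokhorov
   inequality holds; level k = 0 always does. *)
Lemma couplings_of_near_prokhorov (R : realType) (S : nat -> completeNormedModType R)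
    (hsep : forall n, separable_space (S n)) (dX dY : nat -> measure_display)
    (OX : forall n, measurableType (dX n)) (OY : forall n, measurableType (dY n))
    (PX : forall n, probability (OX n) R) (PY : forall n, probability (OY n) R)
    (X : forall n, OX n -> S n) (Y : forall n, OY n -> S n) :
  (forall n, random_element (R := R) (X n)) ->
  (forall n, random_element (R := R) (Y n)) ->
  (forall e, 0 < e ->
    \forall n \near \oo, prokhorov_le (PX n) (PY n) (X n) (Y n) e) ->
  exists P : forall n, probability (OX n * OY n)%type R,
    couplings PX PY X Y P (fun n w => X n w.1) (fun n w => Y n w.2) /\
    cvg_prob0 P (fun n w => `|X n w.1 - Y n w.2|).
Proof.
move=> rX rY hprok.
pose good n k := `[< prokhorov_le (PX n) (PY n) (X n) (Y n) k.+1%:R^-1 >].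
have good0 n : good n 0%N.
  (* At [k = 0] the allowed defect is 1, which bounds every probability. *)
  apply/asboolP => A bA; rewrite invr1.
  apply: (le_trans (probability_le1 _ (rX n _ bA))).
  by rewrite leeDr.
(* The cap [j <= n] makes the maximum exist even when every level holds, as for equal laws. *)
have best n : exists k, good n k /\ (forall j, (j <= n)%N -> good n j -> (j <= k)%N).
  have exP : exists k, (k <= n)%N && good n k by exists 0%N; rewrite good0.
  have ubP k : (k <= n)%N && good n k -> (k <= n)%N by case/andP.
  case: (ex_maxnP exP ubP) => k /andP[_ gk] kmax; exists k; split => // j jn gj.
  by apply: kmax; rewrite jn gj.
have [kappa hkappa] := choice best.
have coup n := strassen_coupling (hsep n) (rX n) (rY n)
  (ltac:(by rewrite invr_gt0 ltr0Sn) : 0 < (kappa n).+1%:R^-1) (asboolW (hkappa n).1).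
have [P HP] : exists P : forall n, probability (OX n * OY n)%type R, forall n,
    [/\ forall A, measurable A -> P n (fst @^-1` A) = PX n A,
        forall B, measurable B -> P n (snd @^-1` B) = PY n B &
        (P n [set w | (5 * (kappa n).+1%:R^-1 <= `|X n w.1 - Y n w.2|)%R] <=
         (3 * (kappa n).+1%:R^-1)%:E)%E].
  by exists (fun n => sval (cid (coup n))) => n; exact: (svalP (cid (coup n))).
have rX' n : random_element (R := R) (fun w : OX n * OY n => X n w.1).
  move=> A bA; rewrite (_ : _ @^-1` _ = setT `&` fst @^-1` (X n @^-1` A)) ?setTI //.
  by rewrite -[X in measurable X]setTI; apply: measurable_fst => //; exact: rX.
have rY' n : random_element (R := R) (fun w : OX n * OY n => Y n w.2).
  move=> A bA; rewrite (_ : _ @^-1` _ = setT `&` snd @^-1` (Y n @^-1` A)) ?setTI //.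
  by rewrite -[X in measurable X]setTI; apply: measurable_snd => //; exact: rY.
exists P; split.
  move=> n; have [h1 h2 _] := HP n; split => // A bA.
  - exact: (h1 _ (rX n _ bA)).
  - exact: (h2 _ (rY n _ bA)).
move=> eta eta0; apply: near_le_cvge0 => [n|e e0]; first exact: measure_ge0.
(* A coupling at level [u] is off by [5 * u] or more with probability at most [3 * u], so
   [u <= eta / 5] and [u <= e / 3] are required. *)
pose m := Num.min (eta / 5) (e / 3).
have m0 : 0 < m by rewrite lt_min !divr_gt0.
have [K Km] : exists K : nat, K.+1%:R^-1 <= m.
  exists (Num.truncn m^-1); rewrite -[leRHS]invrK lef_pV2 ?posrE ?invr_gt0 ?ltr0Sn //.
  exact/ltW/truncnS_gt.
have Km1 : K.+1%:R^-1 <= eta / 5 by apply: (le_trans Km); rewrite ge_min lexx.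
have Km2 : K.+1%:R^-1 <= e / 3 by apply: (le_trans Km); rewrite ge_min lexx orbT.
have K0 : 0 < K.+1%:R^-1 :> R by rewrite invr_gt0 ltr0Sn.
near=> n.
(* For large [n] the fixed level [K] is good and below the cap, so the best level is at least
   [K]. *)
have Kk : (K <= kappa n)%N.
  apply: (hkappa n).2; first by near: n; exact: nbhs_infty_ge.
  by apply/asboolP; near: n; exact: hprok.
have kK : (kappa n).+1%:R^-1 <= K.+1%:R^-1 :> R.
  by rewrite lef_pV2 ?posrE ?ltr0Sn // ler_nat.
have [_ _ hn] := HP n.
move: (le_trans kK Km1) (le_trans kK Km2) hn.
move: (_.+1%:R^-1) => u u_eta u_e hn.
apply: (@le_trans _ _ (3 * u)%:E); last by rewrite lee_fin; lra.
apply: le_trans hn.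
have mg := measurable_fun_norm_sub (hsep n) (rX' n) (rY' n).
apply: le_measure; rewrite ?inE.
- by under eq_set do rewrite normr_id; exact: measurable_ge_set mg.
- exact: measurable_ge_set mg.
- by move=> w /=; rewrite normr_id => h; lra.
Unshelve. all: by end_near. Qed.

Theorem theorem6 (R : realType) (S : nat -> completeNormedModType R)
  (hsep : forall n, separable_space (S n))
  (dX dY : nat -> measure_display)
  (OX : forall n, measurableType (dX n)) (OY : forall n, measurableType (dY n))
  (PX : forall n, probability (OX n) R) (PY : forall n, probability (OY n) R)
  (X : forall n, OX n -> S n) (Y : forall n, OY n -> S n)
  (hX : forall n, random_element (R:=R) (X n))
  (hY : forall n, random_element (R:=R) (Y n)) :
  let cond_i :=
    exists (d : nat -> measure_display) (Om : forall n, measurableType (d n))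
           (P : forall n, probability (Om n) R) (X' Y' : forall n, Om n -> S n),
      couplings PX PY X Y P X' Y' /\
      cvg_prob0 P (fun n w => `|X' n w - Y' n w|) in
  let cond_ii := tight_norm PX X \/ tight_norm PY Y in
  let cond_iii :=
    exists (d : nat -> measure_display) (Om : forall n, measurableType (d n))
           (P : forall n, probability (Om n) R) (X' Y' : forall n, Om n -> S n),
      couplings PX PY X Y P X' Y' /\
      forall (r : R), 1 <= r ->
      forall f : forall n, S n -> R, (forall n, PL r (f n)) ->
        cvg_prob0 P (fun n w => f n (X' n w) - f n (Y' n w)) in
  (cond_i /\ cond_ii -> cond_iii) /\ (cond_iii -> cond_i).
Proof.
move=> cond_i cond_ii cond_iii; split; last first.
  (* The distance functions lie in the class with [r = 1]. The given coupling serves to compare the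
     two laws; the one for (i) is built anew on [OX n * OY n]. *)
  move=> [d [Om [P [X' [Y' [XY hPL]]]]]].
  have hprok := near_prokhorov_le XY (hPL 1 (lexx 1)).
  have [Q hQ] := couplings_of_near_prokhorov hsep hX hY hprok.
  by do 5 eexists; exact: hQ.
move=> [[d [Om [P [X' [Y' [XY XYp]]]]]] tight].
exists d, Om, P, X', Y'; split => // r r1 f fPL.
have rX' n : random_element (R := R) (X' n) by case: (XY n).
have rY' n : random_element (R := R) (Y' n) by case: (XY n).
case: tight => [tX|tY].
  apply: (cvg_prob0_PL hsep rX' rY' _ XYp r1 fPL).
  by apply: (tight_norm_same_law _ tX) => n; case: (XY n).
(* The argument is symmetric in the two sequences, so tightness of [Y] is handled by swapping
   them. *)
have YXp : cvg_prob0 P (fun n w => `|Y' n w - X' n w|).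
  by move=> e e0; under eq_fun do under eq_set do rewrite distrC; exact: XYp.
move=> e e0; under eq_fun do under eq_set do rewrite distrC.
apply: (cvg_prob0_PL hsep rY' rX' _ YXp r1 fPL) => //.
by apply: (tight_norm_same_law _ tY) => n; case: (XY n).
Qed.
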